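(* Let $B:\mathbb{R}^{\hat n}\to\mathbb{R}^{\hat m}$ and $G:\mathbb{R}^{\hat n}\to\mathbb{R}^{\hat l}$ be twice continuously differentiable, let $D\subseteq\mathbb{R}^{\hat l}$ be a polyhedral set (finite union of convex polyhedral sets), $\Gamma:=\{z\mid G(z)\in D\}$ and $\Omega:=\{B(z)\mid z\in\Gamma\}$. Let $\bar\omega\in\Omega$ and $\bar z\in\Sigma_{\bar\omega}$ be such that $\nabla B(\bar z)w=0$, $w\in L_{\bar z}$ imply $w=0$. Consider $\gamma_B>0$ and an open neighborhood $\widetilde W$ of $\bar z$ such that $$\min\{\|\nabla B(\bar z)w\|\mid w\in L_{\bar z},\|w\|=1\}>\gamma_B,$$ $$\|\nabla B(z)w\|\ge\gamma_B\|w\|\ \ \forall z\in\Gamma\cap\widetilde W,\ w\in L_z,\qquad \|B(z_1)-B(z_2)\|\ge\gamma_B\|z_1-z_2\|\ \ \forall z_1,z_2\in\Gamma\cap\widetilde W.$$ Consider open neighborhoods $\mathcal O$ of $\bar\omega$ and $W\subseteq\widetilde W$ of $\bar z$ and a bijective mapping $\hat z:\Omega\cap\mathcal O\to\Gamma\cap W$ which is Lipschitzian on $\Omega\cap\mathcal O$ with constant $1/\gamma_B$ and satisfies $\big(B^{-1}(\omega)\cap\Gamma\big)\cap W=\{\hat z(\omega)\}$ for all $\omega\in\Omega\cap\mathcal O$. Then for every $\omega\in\Omega\cap\mathcal O$ $$\widehat N_\Omega(\omega)=\{\omega^*\mid\nabla B(\hat z(\omega))^T\omega^*\in\widehat N_\Gamma(\hat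 z(\omega))\}.$$ Further, for every $\eta\in T_\Omega(\omega)$ there holds $$N_\Omega(\omega;\eta)=\{\omega^*\mid\nabla B(\hat z(\omega))^T\omega^*\in N_\Gamma(\hat z(\omega);\hat z'(\omega;\eta))\}.$$
   Context: For a set $C$ and $z\in C$: $T_C(z)=\{u\mid\exists t_k\downarrow0,u_k\to u: z+t_ku_k\in C\}$; $\widehat N_C(z)=\{v\mid\langle v,z'-z\rangle\le o(\|z'-z\|)\ \forall z'\in C\}$ (empty if $z\notin C$); $N_C(z;u)=\{v\mid\exists t_k\downarrow0,u_k\to u,v_k\to v: v_k\in\widehat N_C(z+t_ku_k)\}$. For a set $C$, $C^+:=\mathrm{span}(C-C)$. For $z\in\Gamma$, $L_z:=\{w\mid\nabla G(z)w\in(T_D(G(z)))^+\}$. A minimum over the empty set is $+\infty$. $\Sigma_{\bar\omega}:=\{z\mid\text{for every sequence }\omega^k\to\bar\omega\text{ with }\omega^k\in\Omega\text{ there exist }z^k\to z\text{ with }z^k\in B^{-1}(\omega^k)\cap\Gamma\}$. For $\omega\in\Omega\cap\mathcal O$ and $\eta\in T_\Omega(\omega)$, $\hat z'(\omega;\eta)\in T_\Gamma(\hat z(\omega))$ denotes the limit $\lim_{k\to\infty}\big(\hat z(\omega+t_k\eta_k)-\hat z(\omega)\big)/t_k$, which (in this setting) exists and is the same for all sequences $t_k\downarrow0$, $\eta_k\to\eta$ with $\omega+t_k\eta_k\in\Omega$; it is the unique $w$ with $\nabla B(\hat z(\omega))w=\eta$ and $w\in L_{\hat z(\omega)}$. 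*)

(* Defs.v *)
From HB Require Import structures.
From mathcomp Require Import all_boot all_order all_algebra.
From mathcomp Require Import all_classical all_reals all_analysis.

Set Implicit Arguments.
Unset Strict Implicit.
Unset Printing Implicit Defensive.

Import Order.TTheory GRing.Theory Num.Theory.
Import numFieldNormedType.Exports.

Local Open Scope classical_set_scope.
Local Open Scope ring_scope.

(* Points of R^n are row vectors. The norm `|x| of 'rV[R]_n in the library is
   the max norm; it induces the topology, but every quantitative estimate is
   stated with the Euclidean norm [enorm]. *)
Definition dot (R : realType) (n : nat) (x y : 'rV[R]_n) : R :=
  \sum_(i < n) x ord0 i * y ord0 i.

Definition enorm (R : realType) (n : nat) (x : 'rV[R]_n) : R :=
  Num.sqrt (dot x x).

(* In finite dimension, continuity of all second directional derivatives is
   continuity of the second derivative. *)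
Definition twice_cont_differentiable (R : realType) (n m : nat)
    (f : 'rV[R]_n -> 'rV[R]_m) : Prop :=
  [/\ forall x, differentiable f x,
      forall v x, differentiable ('D_v f) x &
      forall v w, continuous ('D_w ('D_v f))].

(* The adjoint of w |-> 'd f z w: since 'd f z w = w *m 'J f z for row vectors,
   dot y ('d f z w) = dot (adjoint_diff f z y) w. *)
Definition adjoint_diff (R : realType) (n m : nat)
    (f : 'rV[R]_n -> 'rV[R]_m) (z : 'rV[R]_n) (y : 'rV[R]_m) : 'rV[R]_n :=
  y *m (jacobian f z)^T.

Definition convex_polyhedral (R : realType) (n : nat) (C : set 'rV[R]_n) : Prop :=
  exists (k : nat) (a : 'I_k -> 'rV[R]_n) (b : 'I_k -> R),
    C = [set x | forall i, dot (a i) x <= b i].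

Definition polyhedral (R : realType) (n : nat) (D : set 'rV[R]_n) : Prop :=
  exists (p : nat) (C : 'I_p -> set 'rV[R]_n),
    (forall i, convex_polyhedral (C i)) /\ D = \bigcup_i C i.

(* t_k \downarrow 0 : positive numbers tending to 0, not necessarily monotone *)
Definition to_zero_pos (R : realType) (t : nat -> R) : Prop :=
  (forall k, 0 < t k) /\ t @ \oo --> (0 : R).

Definition tangent_cone (R : realType) (n : nat) (C : set 'rV[R]_n)
    (z : 'rV[R]_n) : set 'rV[R]_n :=
  [set u | exists (t : nat -> R) (u_ : nat -> 'rV[R]_n),
     [/\ to_zero_pos t, u_ @ \oo --> u & forall k, C (z + t k *: u_ k)]].

(* <v, z' - z> <= o(|z' - z|) for z' in C, with the Landau symbol
   (as z' --> z) spelled out *)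
Definition regular_normal_cone (R : realType) (n : nat) (C : set 'rV[R]_n)
    (z : 'rV[R]_n) : set 'rV[R]_n :=
  [set v | C z /\ forall e : R, 0 < e ->
     \forall z' \near z, C z' -> dot v (z' - z) <= e * enorm (z' - z)].

Definition dir_normal_cone (R : realType) (n : nat) (C : set 'rV[R]_n)
    (z u : 'rV[R]_n) : set 'rV[R]_n :=
  [set v | exists (t : nat -> R) (u_ v_ : nat -> 'rV[R]_n),
     [/\ to_zero_pos t, u_ @ \oo --> u, v_ @ \oo --> v &
         forall k, regular_normal_cone C (z + t k *: u_ k) (v_ k)]].

Definition span_diff (R : realType) (n : nat) (C : set 'rV[R]_n) :
    set 'rV[R]_n :=
  [set w | exists X : seq 'rV[R]_n,
     (forall x, x \in X -> exists c1 c2, [/\ C c1, C c2 & x = c1 - c2]) /\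
     w \in <<X>>%VS].

Definition lin_space (R : realType) (n l : nat) (G : 'rV[R]_n -> 'rV[R]_l)
    (D : set 'rV[R]_l) (z : 'rV[R]_n) : set 'rV[R]_n :=
  [set w | span_diff (tangent_cone D (G z)) ('d G z w)].

Definition Sigma_set (R : realType) (n m : nat) (B : 'rV[R]_n -> 'rV[R]_m)
    (Gamma : set 'rV[R]_n) (omegabar : 'rV[R]_m) : set 'rV[R]_n :=
  [set z | forall omega_ : nat -> 'rV[R]_m,
     (forall k, (B @` Gamma) (omega_ k)) -> omega_ @ \oo --> omegabar ->
     exists2 z_ : nat -> 'rV[R]_n, z_ @ \oo --> z &
       forall k, (B @^-1` [set omega_ k] `&` Gamma) (z_ k)].

(* [w] is the limit of (f (x + t_k h_k) - f x) / t_k for all t_k \downarrow 0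
   and h_k --> h with x + t_k h_k in A. When h is tangent to A at x such
   sequences exist, so there is at most one such [w]. *)
Definition is_dir_deriv_along (R : realType) (m n : nat) (A : set 'rV[R]_m)
    (f : 'rV[R]_m -> 'rV[R]_n) (x h : 'rV[R]_m) (w : 'rV[R]_n) : Prop :=
  forall (t : nat -> R) (h_ : nat -> 'rV[R]_m),
    to_zero_pos t -> h_ @ \oo --> h -> (forall k, A (x + t k *: h_ k)) ->
    (fun k => (t k)^-1 *: (f (x + t k *: h_ k) - f x)) @ \oo --> w.

(* Main.v *)
Require Import Defs.
From HB Require Import structures.
From mathcomp Require Import all_boot all_order all_algebra.
From mathcomp Require Import all_classical all_reals all_analysis.
From mathcomp Require Import lra.

(* The derivative of [B] is injective on each linear space [lin_space G D z],
   which contains the tangent cone of [Gamma] at [z]. Regular normals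
   transport along the bi-Lipschitz correspondence [z <-> B z] by
   first-order expansion. The difference quotients of [zhat] are bounded and each
   of their cluster points is a tangent [w] to [Gamma] with ['d B z w =
   eta]; injectivity makes it unique, whence the directional derivative. For
   directional normals, the inclusion from [Gamma] to [Omega] requires
   lifting normals [v_k] at [z_k] to the image space, which is possible up
   to a vector orthogonal to [lin_space G D z_k], hence without leaving the
   regular normal cone. *)

Import Order.TTheory GRing.Theory Num.Theory.
Import numFieldNormedType.Exports.

Local Open Scope classical_set_scope.
Local Open Scope ring_scope.

(** * The Euclidean inner product and its norm *)

Lemma dotE {R : realType} {n : nat} (x y : 'rV[R]_n) :
  dot x y = (x *m y^T) ord0 ord0.
Proof. by rewrite mxE; apply: eq_bigr => i _; rewrite mxE. Qed.

Lemma dotC {R : realType} {n : nat} (x y : 'rV[R]_n) : dot x y = dot y x.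
Proof. by apply: eq_bigr => i _; rewrite mulrC. Qed.

Lemma dotDl {R : realType} {n : nat} (x y z : 'rV[R]_n) :
  dot (x + y) z = dot x z + dot y z.
Proof. by rewrite !dotE mulmxDl mxE. Qed.

Lemma dotDr {R : realType} {n : nat} (x y z : 'rV[R]_n) :
  dot z (x + y) = dot z x + dot z y.
Proof. by rewrite dotC dotDl !(dotC z). Qed.

Lemma dotZl {R : realType} {n : nat} (a : R) (x y : 'rV[R]_n) :
  dot (a *: x) y = a * dot x y.
Proof. by rewrite !dotE -scalemxAl mxE. Qed.

Lemma dotZr {R : realType} {n : nat} (a : R) (x y : 'rV[R]_n) :
  dot x (a *: y) = a * dot x y.
Proof. by rewrite dotC dotZl dotC. Qed.

Lemma dotNl {R : realType} {n : nat} (x y : 'rV[R]_n) : dot (- x) y = - dot x y.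
Proof. by rewrite -scaleN1r dotZl mulN1r. Qed.

Lemma dotBl {R : realType} {n : nat} (x y z : 'rV[R]_n) :
  dot (x - y) z = dot x z - dot y z.
Proof. by rewrite dotDl dotNl. Qed.

Lemma dotBr {R : realType} {n : nat} (x y z : 'rV[R]_n) :
  dot z (x - y) = dot z x - dot z y.
Proof. by rewrite dotC dotBl !(dotC z). Qed.

Lemma dot0l {R : realType} {n : nat} (x : 'rV[R]_n) : dot 0 x = 0.
Proof. by rewrite dotE mul0mx mxE. Qed.

Lemma dot0r {R : realType} {n : nat} (x : 'rV[R]_n) : dot x 0 = 0.
Proof. by rewrite dotC dot0l. Qed.

Lemma dot_ge0 {R : realType} {n : nat} (x : 'rV[R]_n) : 0 <= dot x x.
Proof. by apply: sumr_ge0 => i _; rewrite -expr2 sqr_ge0. Qed.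

Lemma enorm_ge0 {R : realType} {n : nat} (x : 'rV[R]_n) : 0 <= enorm x.
Proof. exact: sqrtr_ge0. Qed.

Lemma sqr_enorm {R : realType} {n : nat} (x : 'rV[R]_n) :
  enorm x ^+ 2 = dot x x.
Proof. by rewrite sqr_sqrtr// dot_ge0. Qed.

Lemma normr_coord_le {R : realType} {n : nat} (x : 'rV[R]_n) i :
  `|x ord0 i| <= `|x|.
Proof.
by rewrite [leRHS]/Num.norm /= mx_normrE; apply: (le_bigmax _ _ (ord0, i)).
Qed.

Lemma enorm_le_norm {R : realType} {n : nat} (x : 'rV[R]_n) :
  enorm x <= n%:R * `|x|.
Proof.
have H : dot x x <= n%:R * `|x| ^+ 2.
  have -> : n%:R * `|x| ^+ 2 = \sum_(i < n) `|x| ^+ 2.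
    by rewrite sumr_const card_ord mulr_natl.
  apply: ler_sum => i _.
  by rewrite -expr2 -real_normK ?num_real// lerXn2r ?nnegrE// normr_coord_le.
rewrite -(ler_pXn2r (ltn0Sn 1)) ?nnegrE ?enorm_ge0 ?mulr_ge0//.
rewrite sqr_enorm (le_trans H)// exprMn ler_wpM2r ?sqr_ge0//.
(* The sum gives the factor [n] for the squared norm, and [n <= n ^ 2] turns it into the simple,
   non-sharp constant [n] for the norm. *)
by rewrite -natrX ler_nat; case: (n) => // k; rewrite leq_pmulr.
Qed.

Lemma norm_le_enorm {R : realType} {n : nat} (x : 'rV[R]_n) : `|x| <= enorm x.
Proof.
rewrite [leLHS]/Num.norm /= mx_normrE; apply/bigmax_leP; split=> [|[i j] _ /=].
  exact: enorm_ge0.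
rewrite -(ler_pXn2r (ltn0Sn 1)) ?nnegrE ?enorm_ge0// sqr_enorm real_normK ?num_real//.
rewrite (ord1 i) /dot (bigD1 j)//= -expr2 lerDl.
by apply: sumr_ge0 => k _; rewrite -expr2 sqr_ge0.
Qed.

Lemma enorm0 {R : realType} {n : nat} : enorm (0 : 'rV[R]_n) = 0.
Proof.
apply/eqP; rewrite eq_le enorm_ge0 andbT (le_trans (enorm_le_norm _))//.
by rewrite normr0 mulr0.
Qed.

Lemma enorm_eq0 {R : realType} {n : nat} (x : 'rV[R]_n) : enorm x = 0 -> x = 0.
Proof.
by move=> x0; apply/eqP; rewrite -normr_le0 -x0 norm_le_enorm.
Qed.

(** Cauchy-Schwarz: with [a], [b] the norms of [x], [y], the square of [b *: x - a *: y] expands to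
    [2 * a * b * (a * b - dot x y)], which is nonnegative. *)
Lemma dot_le {R : realType} {n : nat} (x y : 'rV[R]_n) :
  dot x y <= enorm x * enorm y.
Proof.
have [y0|y0] := eqVneq (enorm y) 0.
  by rewrite y0 mulr0 (enorm_eq0 _ y0) dot0r.
have yp : 0 < enorm y by rewrite lt_def y0 enorm_ge0.
have [x0|x0] := eqVneq (enorm x) 0.
  by rewrite x0 mul0r (enorm_eq0 _ x0) dot0l.
have xp : 0 < enorm x by rewrite lt_def x0 enorm_ge0.
have := dot_ge0 (enorm y *: x - enorm x *: y).
rewrite dotBl !dotBr !dotZl !dotZr -!sqr_enorm (dotC y x).
set a := enorm x in xp *; set b := enorm y in yp *; set d := dot x y => H.
have : 0 <= (a * b) * (a * b - d) by nra.
by rewrite pmulr_rge0 ?mulr_gt0// subr_ge0.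
Qed.

Lemma enormD {R : realType} {n : nat} (x y : 'rV[R]_n) :
  enorm (x + y) <= enorm x + enorm y.
Proof.
rewrite -(ler_pXn2r (ltn0Sn 1)) ?nnegrE ?enorm_ge0 ?addr_ge0 ?enorm_ge0//.
rewrite sqr_enorm dotDl !dotDr -!sqr_enorm (dotC y x).
by have := dot_le x y; nra.
Qed.

Lemma enormN {R : realType} {n : nat} (x : 'rV[R]_n) : enorm (- x) = enorm x.
Proof. by rewrite /enorm dotNl dotC dotNl opprK. Qed.

Lemma enormZ {R : realType} {n : nat} (a : R) (x : 'rV[R]_n) :
  enorm (a *: x) = `|a| * enorm x.
Proof.
by rewrite /enorm dotZl dotZr mulrA -expr2 sqrtrM ?sqr_ge0// sqrtr_sqr.
Qed.

(** * First-order estimates in the Euclidean norm *)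

Lemma diffE_jacobian {R : realType} {n m : nat} (f : 'rV[R]_n -> 'rV[R]_m) (z w : 'rV[R]_n) :
  'd f z w = w *m 'J f z.
Proof. by rewrite /jacobian mul_rV_lin1. Qed.

Lemma dot_adjoint_diff {R : realType} {n m : nat} (f : 'rV[R]_n -> 'rV[R]_m)
    (z w : 'rV[R]_n) (y : 'rV[R]_m) :
  dot (adjoint_diff f z y) w = dot y ('d f z w).
Proof. by rewrite diffE_jacobian !dotE trmx_mul mulmxA. Qed.

Lemma diff_enorm_bound {R : realType} {n m : nat} (f : 'rV[R]_n -> 'rV[R]_m)
    (z : 'rV[R]_n) : differentiable f z ->
  exists2 C : R, 0 < C & forall w, enorm ('d f z w) <= C * enorm w.
Proof.
move=> /diff_continuous /linear_lipschitz[k k0 H].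
(* The factor [m.+1], rather than [m], keeps the constant positive when [m = 0]; the same device
   recurs below. *)
exists (m.+1%:R * k) => [|w]; first by rewrite mulr_gt0.
rewrite (le_trans (enorm_le_norm _))// -mulrA.
rewrite ler_pM ?ler_nat//.
by rewrite (le_trans (H w))// ler_pM2l// norm_le_enorm.
Qed.

Lemma diff_enorm_near {R : realType} {n m : nat} (f : 'rV[R]_n -> 'rV[R]_m)
    (z : 'rV[R]_n) : differentiable f z -> forall e : R, 0 < e ->
  \forall z' \near z, enorm (f z' - f z - 'd f z (z' - z)) <= e * enorm (z' - z).
Proof.
move=> dfz e e0.
have /diff_locallyP[_ /eqaddoP H] := dfz.
have d0 : 0 < e / m.+1%:R by rewrite divr_gt0.
rewrite (near_shift 0 z).
move: (H _ d0); apply: filterS => h /=.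
rewrite subr0 /shift /= addrK => Hh.
rewrite (le_trans (enorm_le_norm _))//.
apply: (@le_trans _ _ (m.+1%:R * (e / m.+1%:R * `|h|))); last first.
  by rewrite mulrA mulrCA divff ?pnatr_eq0// mulr1 ler_pM2l// norm_le_enorm.
rewrite ler_pM ?ler_nat//.
by move: Hh; rewrite -addrA -opprD; apply: le_trans.
Qed.

Lemma diff_lipschitz_near {R : realType} {n m : nat} (f : 'rV[R]_n -> 'rV[R]_m)
    (z : 'rV[R]_n) : differentiable f z ->
  exists2 C : R, 0 < C &
    \forall z' \near z, enorm (f z' - f z) <= C * enorm (z' - z).
Proof.
move=> dfz; have [C C0 HC] := diff_enorm_bound f z dfz.
exists (1 + C) => [|]; first by rewrite addr_gt0.
move: (diff_enorm_near f z dfz 1 ltr01); apply: filterS => z' Hz'.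
rewrite -(subrK ('d f z (z' - z)) (f z' - f z)) (le_trans (enormD _ _))//.
by rewrite mulrDl lerD.
Qed.

Lemma near_enorm_lt {R : realType} {n : nat} (z : 'rV[R]_n) (P : set 'rV[R]_n) :
  nbhs z P -> exists2 d : R, 0 < d & forall z', enorm (z' - z) < d -> P z'.
Proof.
move=> /nbhs_ballP[d d0 dP]; exists d => // z' Hz'; apply: dP.
by rewrite -ball_normE /= distrC (le_lt_trans (norm_le_enorm _)).
Qed.

(** * Transport of regular normals along a differentiable map *)

(** Up to a first-order remainder, ['d B z (z' - z)] is the increment of [B]. Normality of [v]
    controls its pairing with the increment, which is itself [O(enorm (z' - z))], and Cauchy-Schwarz
    controls the remainder. *)
Lemma regular_normal_cone_preimage {R : realType} {n m : nat}
    (B : 'rV[R]_n -> 'rV[R]_m) (C : set 'rV[R]_n) (E : set 'rV[R]_m)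
    (z : 'rV[R]_n) (v : 'rV[R]_m) :
  differentiable B z -> C z -> (forall z', C z' -> E (B z')) ->
  regular_normal_cone E (B z) v -> regular_normal_cone C z (adjoint_diff B z v).
Proof.
move=> dB Cz CE [_ Hv]; split=> // e e0.
have [K K0 HK] := diff_lipschitz_near B z dB.
(* Each of the two errors receives [e / 2]: [e1 * K = e / 2] and [enorm v * e2 <= e / 2], the [+ 1]
   covering [v = 0]. *)
pose e1 := e / 2 / K; pose e2 := e / 2 / (enorm v + 1).
have v1 : 0 < enorm v + 1 by rewrite ltr_wpDl ?enorm_ge0.
have e10 : 0 < e1 by rewrite !divr_gt0.
have e20 : 0 < e2 by rewrite !divr_gt0.
have H1 : \forall z' \near z, E (B z') ->
    dot v (B z' - B z) <= e1 * enorm (B z' - B z).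
  exact: (differentiable_continuous dB (Hv _ e10)).
near=> z' => Cz'.
have H4 : dot v (B z' - B z) <= e1 * enorm (B z' - B z).
  move: (CE _ Cz'); near: z'; exact: H1.
have H2 : enorm (B z' - B z) <= K * enorm (z' - z) by near: z'.
have H3 : enorm (B z' - B z - 'd B z (z' - z)) <= e2 * enorm (z' - z).
  by near: z'; exact: diff_enorm_near.
rewrite dot_adjoint_diff.
have -> : dot v ('d B z (z' - z)) =
    dot v (B z' - B z) + dot v (- (B z' - B z - 'd B z (z' - z))).
  by rewrite -dotDr opprB [_ - B z + _]addrC subrK.
rewrite [e in e * _]splitr mulrDl lerD//.
  rewrite (le_trans H4)// (le_trans (ler_wpM2l (ltW e10) H2))//.
  by rewrite mulrA /e1 divfK ?gt_eqF.
rewrite (le_trans (dot_le _ _))// enormN.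
rewrite (le_trans (ler_wpM2l (enorm_ge0 _) H3))// mulrA ler_wpM2r ?enorm_ge0//.
rewrite /e2 mulrCA ger_pMr ?divr_gt0// ler_pdivrMr// mul1r lerDl//.
Unshelve. all: by end_near. Qed.

(** The same expansion read backwards through the right inverse [g]: the errors are small relative
    to [enorm (g o' - g o)], and the Lipschitz bound makes them small relative to
    [enorm (o' - o)]. *)
Lemma regular_normal_cone_image {R : realType} {n m : nat}
    (B : 'rV[R]_n -> 'rV[R]_m) (C : set 'rV[R]_n) (E : set 'rV[R]_m)
    (g : 'rV[R]_m -> 'rV[R]_n) (K : R) (o v : 'rV[R]_m) :
  0 < K -> differentiable B (g o) -> E o ->
  (\forall o' \near o, E o' ->
     [/\ C (g o'), B (g o') = o' & enorm (g o' - g o) <= K * enorm (o' - o)]) ->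
  regular_normal_cone C (g o) (adjoint_diff B (g o) v) ->
  regular_normal_cone E o v.
Proof.
move=> K0 dB Eo Hg [_ Hv]; split=> // e e0.
have Bgo : B (g o) = o by have [] := nbhs_singleton Hg Eo.
(* Both errors are at most [e1 * enorm (g o' - g o)], and [e1 * K = e / 2]. *)
pose e1 := e / 2 / K; pose e2 := e1 / (enorm v + 1).
have v1 : 0 < enorm v + 1 by rewrite ltr_wpDl ?enorm_ge0.
have e10 : 0 < e1 by rewrite !divr_gt0.
have e20 : 0 < e2 by rewrite !divr_gt0.
have [d d0 Hd] := near_enorm_lt _ _ (filterI (Hv _ e10) (diff_enorm_near _ _ dB _ e20)).
have ballK : \forall o' \near o, K * enorm (o' - o) < d.
  apply/nbhs_ballP; exists (d / K / (m.+1%:R)) => [|o'] /=; first by rewrite !divr_gt0.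
  rewrite -ball_normE /= distrC => Ho'.
  rewrite mulrC -ltr_pdivlMr//.
  rewrite ltr_pdivlMr// mulrC in Ho'; apply: le_lt_trans Ho'.
  by rewrite (le_trans (enorm_le_norm _))// ler_wpM2r// ler_nat.
near=> o' => Eo'.
have [Cgo' Bgo' Lip] : [/\ C (g o'), B (g o') = o' & enorm (g o' - g o) <= K * enorm (o' - o)].
  by move: Eo'; near: o'.
have /Hd[/(_ Cgo') H1 H2] : enorm (g o' - g o) < d.
  by apply: le_lt_trans Lip _; near: o'.
rewrite Bgo Bgo' in H2.
have dE : o' - o = 'd B (g o) (g o' - g o) + (o' - o - 'd B (g o) (g o' - g o)).
  by rewrite [RHS]addrC subrK.
rewrite [X in dot v X]dE dotDr -dot_adjoint_diff.
apply: (@le_trans _ _ (e1 * enorm (g o' - g o) + e1 * enorm (g o' - g o))).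
  rewrite lerD// (le_trans (dot_le _ _))//.
  rewrite (le_trans (ler_wpM2l (enorm_ge0 _) H2))// mulrA ler_wpM2r ?enorm_ge0//.
  by rewrite /e2 mulrCA ger_pMr// ler_pdivrMr// mul1r lerDl.
have Ke : e1 * K = e / 2 by rewrite divfK// gt_eqF.
by have := ler_wpM2l (ltW e10) Lip; rewrite mulrA Ke; lra.
Unshelve. all: by end_near. Qed.

(** * Tangents as cluster points of bounded directions *)

(** Choosing with [e = 1 / (k + 1)] builds the sequences once and for all, so that later arguments
    can use cluster points without extracting subsequences. *)
Lemma tangent_cone_approx {R : realType} {n : nat} (C : set 'rV[R]_n)
    (z u : 'rV[R]_n) :
  (forall e : R, 0 < e -> exists (t : R) (p : 'rV[R]_n),
     [/\ 0 < t, t < e, `|u - p| < e & C (z + t *: p)]) ->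
  tangent_cone C z u.
Proof.
move=> H.
have /choice[tp Htp] (k : nat) : exists tp : R * 'rV[R]_n,
    [/\ 0 < tp.1, tp.1 < k.+1%:R^-1, `|u - tp.2| < k.+1%:R^-1 &
        C (z + tp.1 *: tp.2)].
  by have [|t [p Htp]] := H k.+1%:R^-1; [rewrite invr_gt0|exists (t, p)].
exists (fst \o tp), (snd \o tp); split=> [||k]; last by have [] := Htp k.
- split=> [k|]; first by have [] := Htp k.
  apply/cvgrPdist_lt => e e0; near=> k; have [t0 tk _ _] := Htp k.
  rewrite sub0r normrN gtr0_norm//= (lt_trans tk)//.
  by near: k; exact: near_infty_natSinv_lt (PosNum e0).
- apply/cvgrPdist_lt => e e0; near=> k; have [_ _ uk _] := Htp k.
  rewrite (lt_trans uk)//.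
  by near: k; exact: near_infty_natSinv_lt (PosNum e0).
Unshelve. all: by end_near. Qed.

Lemma cluster_tangent_cone {R : realType} {n : nat} {T : Type}
    (F : set_system T) {FF : ProperFilter F} (C : set 'rV[R]_n)
    (z u : 'rV[R]_n) (t : T -> R) (p : T -> 'rV[R]_n) :
  (\forall k \near F, 0 < t k) -> t @ F --> (0 : R) ->
  (\forall k \near F, C (z + t k *: p k)) ->
  cluster (p @ F) u -> tangent_cone C z u.
Proof.
move=> t0 tcvg Cp clu; apply: tangent_cone_approx => e e0.
have te : \forall k \near F, t k < e by exact: cvgr_lt tcvg _ e0.
pose P := [set k | [/\ 0 < t k, t k < e & C (z + t k *: p k)]].
have FP : F P by near=> k; split; near: k.
have pFP : (p @ F) (p @` P) by exact: filterS (@preimage_image _ _ p P) FP.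
have [q [[k [tk0 tke Ck] <-]]] := clu _ _ pFP (nbhsx_ballx u e e0).
by rewrite -ball_normE /= => upk; exists (t k), (p k).
Unshelve. all: by end_near. Qed.

(** Bolzano-Weierstrass for an arbitrary proper filter; it serves both sequences and the filter of
    points tending to [z] inside a set. *)
Lemma bounded_cluster {R : realType} {n : nat} {T : Type}
    (F : set_system T) {FF : ProperFilter F} (p : T -> 'rV[R]_n) (M : R) :
  (\forall k \near F, `|p k| <= M) -> exists u, cluster (p @ F) u.
Proof.
move=> pM.
have cB : compact (closed_ball_ Num.norm (0 : 'rV[R]_n) M).
  apply: bounded_closed_compact; last exact: closed_closed_ball_.
  exists M; split; first exact: num_real.
  move=> x Mx y; rewrite /closed_ball_ /= sub0r normrN => /le_trans; apply.
  exact: ltW.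
have [|u [_ clu]] := cB (p @ F) _; last by exists u.
by apply: filterS pM => k; rewrite /closed_ball_ /= sub0r normrN.
Qed.

Lemma bounded_cvg_cluster {R : realType} {n : nat} {T : Type}
    (F : set_system T) {FF : ProperFilter F} (p : T -> 'rV[R]_n) (M : R)
    (w : 'rV[R]_n) :
  (\forall k \near F, `|p k| <= M) ->
  (forall u, cluster (p @ F) u -> u = w) -> p @ F --> w.
Proof.
move=> pM uniq_w.
(* The radius is large enough for the compact ball to be a neighbourhood of [w] as well as to
   contain [p] eventually. *)
pose M1 := M + `|w| + 1.
have cB : compact (closed_ball_ Num.norm (0 : 'rV[R]_n) M1).
  apply: bounded_closed_compact; last exact: closed_closed_ball_.
  exists M1; split; first exact: num_real.
  move=> x Mx y; rewrite /closed_ball_ /= sub0r normrN => /le_trans; apply.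
  exact: ltW.
have [u clu] := bounded_cluster F p M pM.
have M0 : 0 <= M.
  by have [k] := filter_ex pM; apply: le_trans.
apply: (compact_cluster_set1 (@norm_hausdorff _ _) cB).
- apply/nbhs_ballP; exists 1 => //= y; rewrite -ball_normE /= /closed_ball_ /= sub0r normrN.
  move=> wy; rewrite -(subrK w y) (le_trans (ler_normD _ _))// distrC /M1; lra.
- apply: filterS pM => k; rewrite /closed_ball_ /= sub0r normrN => /le_trans; apply.
  by rewrite /M1 -addrA lerDl addr_ge0.
- by apply/seteqP; split=> x; [exact: uniq_w|move=> ->; rewrite -(uniq_w u)].
Qed.

(* A violating sequence [z' -> z] has unit directions [(z' - z) / |z' - z|],
   whose cluster points are tangent and pair with [v] to at least [e]. *)
Lemma regular_normal_cone_polar {R : realType} {n : nat} (C : set 'rV[R]_n)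
    (z v : 'rV[R]_n) :
  C z -> (forall u, tangent_cone C z u -> dot v u <= 0) ->
  regular_normal_cone C z v.
Proof.
move=> Cz Hv; split=> // e e0.
pose bad := [set z' | C z' /\ e * enorm (z' - z) < dot v (z' - z)].
have [nbad|notnear] := pselect (\forall z' \near z, ~ bad z').
  apply: filterS nbad => z' nb Cz'; rewrite leNgt; apply/negP => lt.
  exact: nb.
(* Points tending to [z] through violations of the inequality: this filter is proper exactly because
   the violations are not excluded near [z]. *)
have FF : ProperFilter (within bad (nbhs z)).
  split; last exact: within_filter.
  by move=> H; apply: notnear; apply: filterS H.
pose t z' := enorm (z' - z).
pose p z' := (t z')^-1 *: (z' - z).
have badF : within bad (nbhs z) bad by exact: withinT.
have t0 z' : bad z' -> 0 < t z'.
  move=> [_ lt]; rewrite lt_def enorm_ge0 andbT.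
  apply/eqP => /enorm_eq0 z0; move: lt.
  by rewrite z0 enorm0 mulr0 dot0r ltxx.
have p1 z' : bad z' -> enorm (p z') = 1.
  move=> bz; rewrite /p enormZ normfV gtr0_norm ?t0// mulVf// gt_eqF//.
  exact: t0.
have tp z' : bad z' -> z + t z' *: p z' = z'.
  by move=> bz; rewrite scalerA divff ?gt_eqF ?t0// scale1r addrC subrK.
have tcvg : t @ within bad (nbhs z) --> (0 : R).
  apply: cvg_within_filter; apply/cvgrPdist_lt => r r0.
  apply/nbhs_ballP; exists (r / n.+1%:R) => [|y]/=; first by rewrite divr_gt0.
  rewrite -ball_normE /= distrC ltr_pdivlMr// => lt.
  rewrite sub0r normrN ger0_norm ?enorm_ge0// (le_lt_trans _ lt)//.
  by rewrite (le_trans (enorm_le_norm _))// mulrC ler_wpM2l// ler_nat.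
have [|u clu] := bounded_cluster (within bad (nbhs z)) p 1.
  by apply: filterS badF => z' bz; rewrite -(p1 _ bz) norm_le_enorm.
have Tu : tangent_cone C z u.
  apply: (cluster_tangent_cone (within bad (nbhs z)) C z u t p) => //.
  - exact: filterS t0 badF.
  - by apply: filterS badF => z' bz; rewrite tp//; case: bz.
have : e <= dot v u; last by move=> /lt_le_trans-/(_ _ e0); rewrite ltNge Hv.
rewrite -subr_ge0 leNgt; apply/negP => neg.
(* A direction within [d] of [u] has a pairing with [v] exceeding [dot v u] by at most
   [e - dot v u], whereas every bad direction pairs to more than [e]. *)
pose d := (e - dot v u) / (n.+1%:R * (enorm v + 1)).
have v1 : 0 < enorm v + 1 by rewrite ltr_wpDl ?enorm_ge0.
have d0 : 0 < d by rewrite divr_gt0 ?mulr_gt0//; lra.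
have FI : (p @ within bad (nbhs z)) (p @` bad).
  exact: filterS (@preimage_image _ _ p bad) badF.
have [q [[z' bz <-]]] := clu _ _ FI (nbhsx_ballx u d d0).
rewrite -ball_normE /= distrC => Hd.
have H1 : e < dot v (p z').
  case: (bz) => _; rewrite /p dotZr -/(t z') => lt.
  by rewrite mulrC ltr_pdivlMr// t0.
have H2 : dot v (p z' - u) <= enorm v * (n.+1%:R * d).
  rewrite (le_trans (dot_le _ _))// ler_wpM2l ?enorm_ge0//.
  rewrite (le_trans (enorm_le_norm _))// ler_pM ?ler_nat//; exact: ltW.
have H3 : enorm v * (n.+1%:R * d) <= e - dot v u.
  rewrite /d invfM [n.+1%:R * _]mulrCA mulVKf ?pnatr_eq0// mulrCA ger_pMr; last lra.
  by rewrite ler_pdivrMr// mul1r lerDl.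
by move: H2; rewrite dotBr; lra.
Qed.

(** * Difference quotients along varying directions *)

(** Boundedness of the directions suffices because the first-order remainder is uniform on balls.
    This allows application to the difference quotients of [zhat] before these are known to
    converge. *)
Lemma diff_quotient_cvg {R : realType} {n m : nat} {T : Type}
    (F : set_system T) {FF : ProperFilter F} (f : 'rV[R]_n -> 'rV[R]_m)
    (z : 'rV[R]_n) (t : T -> R) (p : T -> 'rV[R]_n) (M : R) :
  differentiable f z -> (\forall k \near F, 0 < t k) -> t @ F --> (0 : R) ->
  (\forall k \near F, `|p k| <= M) ->
  (fun k => (t k)^-1 *: (f (z + t k *: p k) - f z) - 'd f z (p k)) @ F --> (0 : 'rV[R]_m).
Proof.
move=> df t0 tcvg pM.
have M0 : 0 <= M.
  by have [k] := filter_ex pM; apply: le_trans.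
apply/cvgrPdist_le => e e0.
pose e1 := e / (n.+1%:R * (M + 1)).
have M1 : 0 < M + 1 by lra.
have e10 : 0 < e1 by rewrite divr_gt0// mulr_gt0.
have /nbhs_ballP[d d0 Hd] := diff_enorm_near f z df e1 e10.
have dM : 0 < d / (M + 1) by rewrite divr_gt0.
move/cvgrPdist_lt: tcvg => /(_ _ dM) tcvg.
near=> k.
have tk0 : 0 < t k by near: k.
have pk : `|p k| <= M by near: k.
have tk : t k < d / (M + 1).
  rewrite (le_lt_trans (ler_norm _))// -normrN -sub0r; near: k; exact: tcvg.
rewrite sub0r normrN.
have /= : ball z d (z + t k *: p k).
  rewrite -ball_normE /= opprD addrA subrr sub0r normrN normrZ gtr0_norm//.
  rewrite ltr_pdivlMr// in tk; apply: le_lt_trans tk.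
  by rewrite ler_pM2l//; lra.
move=> /Hd; rewrite /= [z + _]addrC addrK => H.
have -> : (t k)^-1 *: (f (t k *: p k + z) - f z) - 'd f z (p k) =
    (t k)^-1 *: (f (t k *: p k + z) - f z - 'd f z (t k *: p k)).
  by rewrite linearZ /= [RHS]scalerBr scalerA mulVf ?gt_eqF// scale1r.
rewrite (le_trans (norm_le_enorm _))// enormZ normfV gtr0_norm//.
rewrite ler_pdivrMl// (le_trans H)// enormZ gtr0_norm// mulrCA ler_pM2l//.
have pM1 : enorm (p k) <= n.+1%:R * (M + 1).
  by rewrite (le_trans (enorm_le_norm _))// ler_pM ?ler_nat//; lra.
by rewrite (le_trans (ler_wpM2l (ltW e10) pM1))// /e1 divfK// gt_eqF// mulr_gt0.
Unshelve. all: by end_near. Qed.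

Lemma diff_quotient_cvg_lim {R : realType} {n m : nat} (f : 'rV[R]_n -> 'rV[R]_m)
    (z u : 'rV[R]_n) (t : nat -> R) (p : nat -> 'rV[R]_n) :
  differentiable f z -> to_zero_pos t -> p @ \oo --> u ->
  (fun k => (t k)^-1 *: (f (z + t k *: p k) - f z)) @ \oo --> 'd f z u.
Proof.
move=> df [t0 tcvg] pu.
have pM : \forall k \near \oo, `|p k| <= `|u| + 1.
  move/cvgrPdist_lt: pu => /(_ 1 ltr01); apply: filterS => k.
  move=> lt; rewrite -(subrK u (p k)) (le_trans (ler_normD _ _))// distrC; lra.
have dpu : 'd f z (p k) @[k --> \oo] --> 'd f z u.
  by apply: (continuous_cvg _ _ pu); exact: diff_continuous.
have t0' : \forall k \near \oo, 0 < t k by exact: nearW.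
rewrite -[X in _ --> X]add0r.
have q0 : (fun k => (t k)^-1 *: (f (z + t k *: p k) - f z) - 'd f z (p k))
    @ \oo --> (0 : 'rV[R]_m) by exact: diff_quotient_cvg pM.
have -> : (fun k => (t k)^-1 *: (f (z + t k *: p k) - f z)) =
    (fun k => (t k)^-1 *: (f (z + t k *: p k) - f z) - 'd f z (p k)) \+
    (fun k => 'd f z (p k)) by apply/funext => k; rewrite /= subrK.
exact: cvgD q0 dpu.
Qed.

Lemma tangent_cone_diff {R : realType} {n m : nat} (f : 'rV[R]_n -> 'rV[R]_m)
    (C : set 'rV[R]_n) (E : set 'rV[R]_m) (z u : 'rV[R]_n) :
  differentiable f z -> (forall z', C z' -> E (f z')) ->
  tangent_cone C z u -> tangent_cone E (f z) ('d f z u).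
Proof.
move=> df CE [t [p [tz pu Cp]]].
(* With these directions the moving point is exactly [f (z + t k *: p k)], which lies in [E]. *)
exists t, (fun k => (t k)^-1 *: (f (z + t k *: p k) - f z)); split=> //.
  exact: diff_quotient_cvg_lim.
by move=> k; have [t0 _] := tz; rewrite scalerA divff ?gt_eqF// scale1r addrC subrK; exact: CE.
Qed.

(** * Linear subspaces and the lifting of functionals *)

(** Among matrices whose row space lies in [L], one of maximal rank exhausts [L]: adjoining a
    further vector of [L] would increase the rank. *)
Lemma subspace_row_space {R : realType} {n : nat} (L : set 'rV[R]_n) :
  L 0 -> (forall a u v, L u -> L v -> L (a *: u + v)) ->
  exists K : 'M[R]_n, forall w, L w <-> (w <= K)%MS.
Proof.
move=> L0 Llin.
pose P k := `[< exists K : 'M[R]_n, (forall w : 'rV_n, (w <= K)%MS -> L w) /\ \rank K = k >].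
have P0 : exists k, P k.
  exists 0%N; apply/asboolP; exists 0; split; last exact: mxrank0.
  by move=> w; rewrite submx0 => /eqP ->.
have Pn k : P k -> (k <= n)%N.
  by move=> /asboolP[K [_ <-]]; exact: rank_leq_row.
case: (ex_maxnP P0 Pn) => k /asboolP[K [KL rK]] kmax.
exists K => w; split=> [Lw|]; last exact: KL.
have sK : (K <= K + w)%MS := addsmxSl K w.
have : P (\rank (K + w)%MS).
  apply/asboolP; exists (K + w)%MS; split=> // x /sub_addsmxP[[a b] /= ->].
  rewrite -[a *m K]scale1r; apply: (Llin); first exact/KL/submxMl.
  rewrite [b]mx11_scalar mul_scalar_mx -[_ *: w]addr0.
  exact: Llin.
move=> /kmax; rewrite -rK => rle.
have := addsmxSr K w; move=> /submx_trans; apply.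
by rewrite -(geq_leqif (mxrank_leqif_sup sK)).
Qed.

(* [b] is sought in the image of [L], as [w0 *m J] with [dot (w0 *m J) (w *m J)
   = dot r w] on [L]: an invertible Gram system. *)
Lemma riesz_lower_bound {R : realType} {n m : nat} (L : set 'rV[R]_n)
    (J : 'M[R]_(n, m)) (gamma : R) (r : 'rV[R]_n) :
  L 0 -> (forall a u v, L u -> L v -> L (a *: u + v)) -> 0 < gamma ->
  (forall w, L w -> gamma * enorm w <= enorm (w *m J)) ->
  exists b : 'rV[R]_m, gamma * enorm b <= enorm r /\
    forall w, L w -> dot b (w *m J) = dot r w.
Proof.
move=> L0 Llin g0 lb; have [K0 LK0] := subspace_row_space L L0 Llin.
pose K := row_base K0.
have LK w : L w <-> exists x, w = x *m K.
  rewrite LK0 -(eq_row_base K0); split=> [/submxP|[x ->]]//.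
  exact: submxMl.
(* The Gram matrix of the images of a basis of [L]. If [v *m A = 0], then [v *m K *m J] has norm
   zero; the lower bound gives [v *m K = 0], and independence of the rows of [K] gives [v = 0]. *)
pose A := K *m J *m (K *m J)^T.
have uA : A \in unitmx.
  rewrite -row_free_unit; apply: inj_row_free => v vA.
  have vKJ : enorm (v *m K *m J) = 0.
    apply/eqP; rewrite -(sqrf_eq0 (enorm _)) sqr_enorm dotE.
    have -> : (v *m K *m J) *m (v *m K *m J)^T = v *m A *m v^T.
      by rewrite /A -[v *m K *m J]mulmxA trmx_mul !mulmxA.
    by rewrite vA mul0mx mxE.
  have Lv : L (v *m K) by apply/LK; exists v.
  have /enorm_eq0 vK : enorm (v *m K) = 0.
    apply/eqP; rewrite eq_le enorm_ge0 andbT -(pmulr_rle0 _ g0).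
    by rewrite (le_trans (lb _ Lv))// vKJ.
  by apply: (row_free_inj (row_base_free K0)); rewrite mul0mx.
pose y := r *m K^T *m invmx A.
have bP w : L w -> dot (y *m K *m J) (w *m J) = dot r w.
  move=> /LK[x ->]; rewrite !dotE.
  have -> : (y *m K *m J) *m (x *m K *m J)^T = y *m A *m x^T.
    by rewrite /A -[x *m K *m J]mulmxA trmx_mul !mulmxA.
  by rewrite /y mulmxKV// (trmx_mul x K) mulmxA.
exists (y *m K *m J); split=> //.
have Ly : L (y *m K) by apply/LK; exists y.
(* Testing the identity with [y *m K] itself gives [enorm b ^+ 2 <= enorm r * enorm (y *m K)]; as
   [gamma * enorm (y *m K) <= enorm b], one factor [enorm b] cancels. *)
have := bP _ Ly; rewrite -sqr_enorm => Hb.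
have := le_trans (lb _ Ly) (lexx _); have := dot_le r (y *m K).
rewrite -Hb; move: (enorm_ge0 (y *m K *m J)) (enorm_ge0 r) (enorm_ge0 (y *m K)).
set b := enorm (y *m K *m J); set w := enorm (y *m K); set s := enorm r.
move=> b0 s0 w0 H1 H2.
have [->|bn] := eqVneq b 0; first by rewrite mulr0.
have bp : 0 < b by rewrite lt_def bn.
have : b * (gamma * b) <= b * s by nra.
by rewrite ler_pM2l.
Qed.

Lemma span_diff_lin {R : realType} {n : nat} (C : set 'rV[R]_n) (a : R)
    (u v : 'rV[R]_n) :
  span_diff C u -> span_diff C v -> span_diff C (a *: u + v).
Proof.
move=> [X [HX uX]] [Y [HY vY]]; exists (X ++ Y); split.
  by move=> x; rewrite mem_cat => /orP[/HX|/HY].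
by rewrite span_cat memv_add// memvZ.
Qed.

Lemma span_diff0 {R : realType} {n : nat} (C : set 'rV[R]_n) : span_diff C 0.
Proof. by exists [::]; split=> //; exact: mem0v. Qed.

Lemma tangent_cone0 {R : realType} {n : nat} (C : set 'rV[R]_n) (z : 'rV[R]_n) :
  C z -> tangent_cone C z 0.
Proof.
move=> Cz; apply: tangent_cone_approx => e e0; exists (e / 2), 0.
by rewrite divr_gt0// subr0 normr0 scaler0 addr0; split=> //; lra.
Qed.

Lemma lin_space_lin {R : realType} {n l : nat} (G : 'rV[R]_n -> 'rV[R]_l)
    (D : set 'rV[R]_l) (z : 'rV[R]_n) (a : R) (u v : 'rV[R]_n) :
  lin_space G D z u -> lin_space G D z v -> lin_space G D z (a *: u + v).
Proof.
by rewrite /lin_space /= linearP; exact: span_diff_lin.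
Qed.

Lemma lin_space0 {R : realType} {n l : nat} (G : 'rV[R]_n -> 'rV[R]_l)
    (D : set 'rV[R]_l) (z : 'rV[R]_n) : lin_space G D z 0.
Proof. by rewrite /lin_space /= linear0; exact: span_diff0. Qed.

(** The derivative of [G] maps tangents of the preimage to tangents of [D], and [0] is tangent to
    [D] at [G z], so the image is a difference of two tangents. *)
Lemma tangent_cone_lin_space {R : realType} {n l : nat}
    (G : 'rV[R]_n -> 'rV[R]_l) (D : set 'rV[R]_l) (z u : 'rV[R]_n) :
  differentiable G z -> D (G z) ->
  tangent_cone [set z | D (G z)] z u -> lin_space G D z u.
Proof.
move=> dG DGz Tu; exists [:: 'd G z u]; split; last exact/memv_span/mem_head.
move=> x; rewrite inE => /eqP ->; exists ('d G z u), 0; split.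
- exact: tangent_cone_diff Tu.
- exact: tangent_cone0.
- by rewrite subr0.
Qed.

Lemma regular_normal_coneD {R : realType} {n : nat} (C : set 'rV[R]_n)
    (z u v : 'rV[R]_n) :
  regular_normal_cone C z u -> regular_normal_cone C z v ->
  regular_normal_cone C z (u + v).
Proof.
move=> [Cz Hu] [_ Hv]; split=> // e e0.
have e20 : 0 < e / 2 by rewrite divr_gt0.
near=> z' => Cz'.
have : C z' -> dot u (z' - z) <= e / 2 * enorm (z' - z) by near: z'; exact: Hu.
have : C z' -> dot v (z' - z) <= e / 2 * enorm (z' - z) by near: z'; exact: Hv.
by move=> /(_ Cz') H1 /(_ Cz') H2; rewrite dotDl; lra.
Unshelve. all: by end_near. Qed.

(** * Convergence of vectors, adjoints and shifted sequences *)

Lemma cvg_row {R : realType} {n : nat} (u_ : nat -> 'rV[R]_n) (u : 'rV[R]_n)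
    (c_ : 'I_n -> nat -> R) (c : 'I_n -> R) :
  (forall k i, u_ k ord0 i = c_ i k) -> (forall i, u ord0 i = c i) ->
  (forall i, c_ i @ \oo --> c i) -> u_ @ \oo --> u.
Proof.
move=> Eu_ Eu H; apply/cvgrPdist_lt => e e0.
have : \forall k \near \oo, forall i : 'I_n, `|c i - c_ i k| < e.
  by apply: filter_forall => i; move/cvgrPdist_lt: (H i); exact.
apply: filterS => k Hk; rewrite [ltLHS]/Num.norm /= mx_normrE.
by apply/bigmax_ltP; split=> // -[i j] _ /=; rewrite (ord1 i) !mxE Eu_ Eu.
Qed.

Lemma cvg_coord {R : realType} {n : nat} (u_ : nat -> 'rV[R]_n) (u : 'rV[R]_n) i :
  u_ @ \oo --> u -> (fun k => u_ k ord0 i) @ \oo --> (u ord0 i : R).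
Proof.
move=> uc.
apply/cvgrPdist_lt => e e0; near=> k.
rewrite (_ : _ - _ = (u - u_ k) ord0 i); last by rewrite !mxE.
rewrite (le_lt_trans (normr_coord_le _ _))//; near: k.
by move/cvgrPdist_lt: uc; exact.
Unshelve. all: by end_near. Qed.

Lemma cvg_dot {R : realType} {n : nat} (u_ v_ : nat -> 'rV[R]_n) (u v : 'rV[R]_n) :
  u_ @ \oo --> u -> v_ @ \oo --> v ->
  (fun k => dot (u_ k) (v_ k)) @ \oo --> (dot u v : R).
Proof.
move=> uc vc; apply: cvg_big => [|i _]; first exact: add_continuous.
by apply: cvgM; exact: cvg_coord.
Qed.

(** This reduces continuity of the adjoint in [z] to that of directional derivatives, the form in
    which [twice_cont_differentiable] provides smoothness. *)
Lemma adjoint_diffE {R : realType} {n m : nat} (f : 'rV[R]_n -> 'rV[R]_m)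
    (z : 'rV[R]_n) (y : 'rV[R]_m) i :
  differentiable f z ->
  adjoint_diff f z y ord0 i = dot y ('D_(delta_mx ord0 i) f z).
Proof.
move=> df; rewrite deriveEjacobian// /adjoint_diff mxE.
by apply: eq_bigr => j _; rewrite -rowE !mxE.
Qed.

Lemma cvg_seq_continuous {R : realType} {n m : nat} (h : 'rV[R]_n -> 'rV[R]_m)
    (z_ : nat -> 'rV[R]_n) (z : 'rV[R]_n) :
  differentiable h z -> z_ @ \oo --> z -> (fun k => h (z_ k)) @ \oo --> h z.
Proof. by move=> dh zc; exact: (cvg_comp _ _ zc (differentiable_continuous dh)). Qed.

Lemma cvg_adjoint_diff {R : realType} {n m : nat} (f : 'rV[R]_n -> 'rV[R]_m)
    (z_ : nat -> 'rV[R]_n) (z : 'rV[R]_n) (y_ : nat -> 'rV[R]_m) (y : 'rV[R]_m) :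
  twice_cont_differentiable f -> z_ @ \oo --> z -> y_ @ \oo --> y ->
  (fun k => adjoint_diff f (z_ k) (y_ k)) @ \oo --> adjoint_diff f z y.
Proof.
move=> [df d2f _] zc yc.
apply: (cvg_row _ _ (fun i k => dot (y_ k) ('D_(delta_mx ord0 i) f (z_ k)))
  (fun i => dot y ('D_(delta_mx ord0 i) f z))) => [k i|i|i].
- exact: adjoint_diffE.
- exact: adjoint_diffE.
have Dc := cvg_seq_continuous ('D_(delta_mx ord0 i) f) z_ z (d2f _ _) zc.
exact: (cvg_dot _ _ _ _ yc Dc).
Qed.

(** By continuity [f u] is a cluster point of [f \o p], and a limit in a Hausdorff space is the only
    cluster point. *)
Lemma cluster_image_eq {R : realType} {n m : nat} {T : Type}
    (F : set_system T) {FF : ProperFilter F} (f : 'rV[R]_n -> 'rV[R]_m)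
    (p : T -> 'rV[R]_n) (u : 'rV[R]_n) (l : 'rV[R]_m) :
  {for u, continuous f} -> cluster (p @ F) u -> f \o p @ F --> l -> f u = l.
Proof.
move=> fu clu fl; apply: (@norm_hausdorff _ 'rV[R]_m) => P Q fuP lQ.
have [q [/= Qq Pq]] := clu (f @^-1` Q) (f @^-1` P) (fl Q lQ) (fu P fuP).
by exists (f q).
Qed.

Lemma cvg_ray {R : realType} {n : nat} (z u : 'rV[R]_n) (t : nat -> R)
    (u_ : nat -> 'rV[R]_n) :
  to_zero_pos t -> u_ @ \oo --> u -> (fun k => z + t k *: u_ k) @ \oo --> z.
Proof.
move=> [_ t0] uu; rewrite -[X in _ --> X]addr0 -(scale0r u).
by apply: cvgD; [exact: cvg_cst | exact: cvgZ].
Qed.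

(** The cones are defined by conditions at every index, so properties that hold only eventually are
    used after dropping an initial segment. *)
Lemma near_infty_shift (P : nat -> Prop) :
  (\forall k \near \oo, P k) -> exists N, forall k, P (k + N)%N.
Proof. by move=> [N _ HN]; exists N => k; apply: HN => /=; rewrite leq_addl. Qed.

Lemma cvg_shift {T : topologicalType} (N : nat) (u_ : nat -> T) (u : T) :
  u_ @ \oo --> u -> (fun k => u_ (k + N)%N) @ \oo --> u.
Proof. by move=> uu; exact: (cvg_comp _ _ (cvg_addnr N) uu). Qed.

Lemma to_zero_pos_shift {R : realType} (N : nat) (t : nat -> R) :
  to_zero_pos t -> to_zero_pos (fun k => t (k + N)%N).
Proof. by move=> [t0 tc]; split=> // ; exact: cvg_shift. Qed.

Lemma cvg0_enorm_le {R : realType} {n m : nat} (C : R) (b_ : nat -> 'rV[R]_m)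
    (r_ : nat -> 'rV[R]_n) :
  0 < C -> (forall k, C * enorm (b_ k) <= enorm (r_ k)) ->
  r_ @ \oo --> (0 : 'rV[R]_n) -> b_ @ \oo --> (0 : 'rV[R]_m).
Proof.
move=> C0 H r0; apply/cvgrPdist_lt => e e0.
have d0 : 0 < C * e / n.+1%:R by rewrite divr_gt0// mulr_gt0.
move/cvgrPdist_lt: r0 => /(_ _ d0); apply: filterS => k; rewrite !sub0r !normrN.
rewrite ltr_pdivlMr// => lt.
rewrite (le_lt_trans (norm_le_enorm _))// -(ltr_pM2l C0) (le_lt_trans (H k))//.
by rewrite (le_lt_trans (enorm_le_norm _))// (le_lt_trans _ lt)// mulrC ler_wpM2l// ler_nat.
Qed.

(** * Normal cones of [Omega] through the local inverse [zhat] *)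

Theorem theorem3p6 (R : realType) (n m l : nat)
    (B : 'rV[R]_n -> 'rV[R]_m) (G : 'rV[R]_n -> 'rV[R]_l)
    (D : set 'rV[R]_l)
    (Gamma : set 'rV[R]_n) (Omega : set 'rV[R]_m)
    (omegabar : 'rV[R]_m) (zbar : 'rV[R]_n)
    (gammaB : R) (Wt : set 'rV[R]_n)
    (O : set 'rV[R]_m) (W : set 'rV[R]_n)
    (zhat : 'rV[R]_m -> 'rV[R]_n)
    (hB : twice_cont_differentiable B)
    (hG : twice_cont_differentiable G)
    (hD : polyhedral D)
    (hGamma : Gamma = [set z | D (G z)])
    (hOmega : Omega = [set B z | z in Gamma])
    (homegabar : Omega omegabar)
    (hzbar : Sigma_set B Gamma omegabar zbar)
    (hinj : forall w, 'd B zbar w = 0 -> lin_space G D zbar w -> w = 0)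
    (hgamma : 0 < gammaB)
    (hWt : open Wt) (hWtz : Wt zbar)
    (* ereal_inf set0 = +oo; otherwise the infimum is attained (continuous
       function on the compact unit sphere of a subspace), hence a minimum *)
    (hmin : (gammaB%:E < ereal_inf
               [set (enorm ('d B zbar w))%:E
               | w in lin_space G D zbar `&` [set w | enorm w = 1%R]])%E)
    (hlb : forall z w, (Gamma `&` Wt) z -> lin_space G D z w ->
       gammaB * enorm w <= enorm ('d B z w))
    (hmetric : forall z1 z2, (Gamma `&` Wt) z1 -> (Gamma `&` Wt) z2 ->
       gammaB * enorm (z1 - z2) <= enorm (B z1 - B z2))
    (hO : open O) (hOomega : O omegabar)
    (hW : open W) (hWz : W zbar) (hWWt : W `<=` Wt)
    (hbij : set_bij (Omega `&` O) (Gamma `&` W) zhat)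
    (hlip : forall o1 o2, (Omega `&` O) o1 -> (Omega `&` O) o2 ->
       enorm (zhat o1 - zhat o2) <= gammaB^-1 * enorm (o1 - o2))
    (hsol : forall omega, (Omega `&` O) omega ->
       (B @^-1` [set omega] `&` Gamma) `&` W = [set zhat omega]) :
  forall omega, (Omega `&` O) omega ->
    regular_normal_cone Omega omega =
      [set omegas | regular_normal_cone Gamma (zhat omega)
                      (adjoint_diff B (zhat omega) omegas)]
    /\
    forall eta, tangent_cone Omega omega eta ->
      exists w, is_dir_deriv_along Omega zhat omega eta w /\
        dir_normal_cone Omega omega eta =
          [set omegas | dir_normal_cone Gamma (zhat omega) w
                          (adjoint_diff B (zhat omega) omegas)].
Proof.
have [dB _ _] := hB; have [dG _ _] := hG.
have zhatP o : (Omega `&` O) o -> [/\ B (zhat o) = o, Gamma (zhat o) & W (zhat o)].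
  by move=> /hsol eqs; have : [set zhat o] (zhat o) by []; rewrite -eqs => -[[]].
have zhatB z : Gamma z -> W z -> O (B z) -> zhat (B z) = z.
  move=> Gz Wz Oz; have oB : (Omega `&` O) (B z) by rewrite hOmega; split=> //; exists z.
  by have : (B @^-1` [set B z] `&` Gamma `&` W) z by []; rewrite hsol.
have OmegaB z : Gamma z -> Omega (B z) by rewrite hOmega => Gz; exists z.
(* Locally [B] maps [Gamma] into [Omega], and [zhat] is a Lipschitz right inverse with values in
   [Gamma], so both transport lemmas apply. *)
have regP o v : (Omega `&` O) o ->
    regular_normal_cone Omega o v <->
    regular_normal_cone Gamma (zhat o) (adjoint_diff B (zhat o) v).
  move=> oO; have [Bz Gz Wz] := zhatP _ oO; split.
    rewrite -{1}Bz; exact: regular_normal_cone_preimage.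
  apply: (regular_normal_cone_image B Gamma Omega zhat gammaB^-1) => //.
  - by rewrite invr_gt0.
  - by case: oO.
  - have : nbhs o O by apply: open_nbhs_nbhs; split=> //; case: oO.
    apply: filterS => o' Oo' Omo'; have [] := zhatP o' (conj Omo' Oo').
    by split=> //; exact: hlip.
have TL z u : Gamma z -> tangent_cone Gamma z u -> lin_space G D z u.
  by rewrite hGamma => Gz; exact: tangent_cone_lin_space.
move=> o oO; split; first by apply/seteqP; split=> v /regP; apply.
have [Bz Gz Wz] := zhatP _ oO; have [Omo Oo] := oO.
have nbO : nbhs o O by apply: open_nbhs_nbhs.
have nbW : nbhs (zhat o) W by apply: open_nbhs_nbhs.
move=> eta Teta.
pose q t (h_ : nat -> 'rV[R]_m) k := (t k)^-1 *: (zhat (o + t k *: h_ k) - zhat o).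
(* Moving from [zhat o] along [q] by [t k] reaches the preimage of [o + t k *: h_ k], so [q]
   supplies directions staying in [Gamma]. *)
have qK t h_ k : 0 < t k -> zhat o + t k *: q t h_ k = zhat (o + t k *: h_ k).
  by move=> tk; rewrite scalerA divff ?gt_eqF// scale1r addrC subrK.
have qbounded t h_ : to_zero_pos t -> h_ @ \oo --> eta ->
    (forall k, Omega (o + t k *: h_ k)) -> exists M, \forall k \near \oo, `|q t h_ k| <= M.
  move=> tz hc Om; have [t0 _] := tz.
  exists (gammaB^-1 * (m%:R * (`|eta| + 1))).
  have hM : \forall k \near \oo, `|h_ k| <= `|eta| + 1.
    move/cvgrPdist_lt: hc => /(_ 1 ltr01); apply: filterS => k.
    move=> lt; rewrite -(subrK eta (h_ k)) (le_trans (ler_normD _ _))// distrC.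
    by rewrite addrC lerD2l ltW.
  have Onear : \forall k \near \oo, O (o + t k *: h_ k) by exact: (cvg_ray o _ _ _ tz hc).
  near=> k; have Ok : O (o + t k *: h_ k) by near: k.
  have hk : `|h_ k| <= `|eta| + 1 by near: k.
  rewrite (le_trans (norm_le_enorm _))// enormZ normfV gtr0_norm//.
  rewrite ler_pdivrMl// (le_trans (hlip _ _ (conj (Om k) Ok) oO))//.
  rewrite [(o + _)%R]addrC addrK enormZ gtr0_norm// mulrCA ler_pM2l//.
  rewrite ler_pM2l ?invr_gt0// (le_trans (enorm_le_norm _))//.
  by rewrite ler_wpM2l.
have qcluster t h_ u : to_zero_pos t -> h_ @ \oo --> eta ->
    (forall k, Omega (o + t k *: h_ k)) -> cluster (q t h_ @ \oo) u ->
    lin_space G D (zhat o) u /\ 'd B (zhat o) u = eta.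
  move=> tz hc Om clu; have [t0 tc] := tz.
  have [M qM] := qbounded t h_ tz hc Om.
  have Onear : \forall k \near \oo, O (o + t k *: h_ k) by exact: (cvg_ray o _ _ _ tz hc).
  have t0' : \forall k \near \oo, 0 < t k by exact: nearW.
  split.
    apply: TL => //; apply: (cluster_tangent_cone \oo Gamma _ u t (q t h_)) => //.
    near=> k; rewrite qK//.
    have Ok : O (o + t k *: h_ k) by near: k.
    by have [] := zhatP _ (conj (Om k) Ok).
  apply: (cluster_image_eq \oo ('d B (zhat o)) (q t h_)) => //.
  have d0 : (fun k => (t k)^-1 *: (B (zhat o + t k *: q t h_ k) - B (zhat o))
      - 'd B (zhat o) (q t h_ k)) @ \oo --> (0 : 'rV[R]_m).
    exact: (diff_quotient_cvg \oo B (zhat o) t (q t h_) M (dB _) t0' tc qM).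
  (* Since [B] undoes [zhat], the difference quotient of [B] along [q] is eventually [h_ k]; hence
     ['d B (zhat o) (q t h_ k)] is eventually equal to this expression. *)
  have : (fun k => h_ k - ((t k)^-1 *: (B (zhat o + t k *: q t h_ k) - B (zhat o))
      - 'd B (zhat o) (q t h_ k))) @ \oo --> eta.
    by rewrite -[X in _ --> X]subr0; exact: cvgB hc d0.
  apply: cvg_trans; apply: near_eq_cvg; near=> k.
  have Ok : O (o + t k *: h_ k) by near: k.
  rewrite qK//; have [-> _ _] := zhatP _ (conj (Om k) Ok).
  rewrite Bz [(o + _)%R]addrC addrK scalerA mulVf ?gt_eqF// scale1r.
  by rewrite opprB addrC subrK.
have uniqL u u' : lin_space G D (zhat o) u -> lin_space G D (zhat o) u' ->
    'd B (zhat o) u = 'd B (zhat o) u' -> u = u'.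
  move=> Lu Lu' eqB; apply/eqP; rewrite -subr_eq0; apply/eqP/enorm_eq0.
  have LB : lin_space G D (zhat o) (u - u').
    by rewrite addrC -scaleN1r; exact: lin_space_lin.
  apply/eqP; rewrite eq_le enorm_ge0 andbT -(pmulr_rle0 _ hgamma).
  by rewrite (le_trans (hlb _ _ (conj Gz (hWWt _ Wz)) LB))// linearB /= eqB subrr enorm0.
(* One sequence witnessing [Teta] supplies a cluster point [w]. By [uniqL], it is the only possible
   cluster point for every other admissible sequence, and boundedness then forces convergence. *)
have [w [Lw Bw dirw]] : exists w, [/\ lin_space G D (zhat o) w,
    'd B (zhat o) w = eta & is_dir_deriv_along Omega zhat o eta w].
  have [t [h_ [tz hc Om]]] := Teta.
  have [M qM] := qbounded t h_ tz hc Om.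
  have [w clw] := bounded_cluster \oo (q t h_) M qM.
  have [Lw Bw] := qcluster t h_ w tz hc Om clw.
  exists w; split=> // t' h' tz' hc' Om'.
  have [M' qM'] := qbounded t' h' tz' hc' Om'.
  apply: (bounded_cvg_cluster \oo (q t' h') M' w qM') => u clu.
  have [Lu Bu] := qcluster t' h' u tz' hc' Om' clu.
  by apply: uniqL => //; rewrite Bu.
exists w; split=> //; apply/seteqP; split=> v.
  move=> [t [h_ [v_ [tz hc vc Nv]]]].
  have Onear : \forall k \near \oo, O (o + t k *: h_ k) by exact: (cvg_ray o _ _ _ tz hc).
  have [N ON] := near_infty_shift _ Onear.
  have Om k : Omega (o + t k *: h_ k) by have [] := Nv k.
  have qc : q t h_ @ \oo --> w by exact: dirw.
  have [t0 _] := tz.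
  (* From [Omega] to [Gamma]: past [N] the points lie in [O], where [regP] pulls each normal back by
     the adjoint at the corresponding point of [Gamma]. *)
  exists (fun k => t (k + N)%N), (fun k => q t h_ (k + N)%N),
    (fun k => adjoint_diff B (zhat o + t (k + N)%N *: q t h_ (k + N)%N) (v_ (k + N)%N)).
  split=> [|||k].
  - exact: to_zero_pos_shift.
  - exact: cvg_shift.
  - apply: cvg_adjoint_diff hB _ (cvg_shift N v_ v vc).
    exact: cvg_ray (to_zero_pos_shift N t tz) (cvg_shift N _ w qc).
  - by rewrite qK//; apply/regP; [split=> //; exact: Om | exact: Nv].
move=> [t [u_ [v_ [tz uc vc Nv]]]].
have zc := cvg_ray (zhat o) w t u_ tz uc.
have Wnear : \forall k \near \oo, W (zhat o + t k *: u_ k) by exact: zc.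
have Onear : \forall k \near \oo, O (B (zhat o + t k *: u_ k)).
  have nO : nbhs (B (zhat o)) O by rewrite Bz.
  exact: (cvg_seq_continuous B _ _ (dB _) zc O nO).
have [N WON] : exists N, forall k, W (zhat o + t (k + N)%N *: u_ (k + N)%N) /\
    O (B (zhat o + t (k + N)%N *: u_ (k + N)%N)).
  apply: (near_infty_shift (fun k => W (zhat o + t k *: u_ k) /\
    O (B (zhat o + t k *: u_ k)))).
  by near=> k; split; near: k.
pose z k := zhat o + t k *: u_ k.
have Gzk k : Gamma (z k) by have [] := Nv k.
(* [v_ k] need not lie in the range of the adjoint of the derivative at [z k];
   the defect [r k] is matched by [b k] up to a vector orthogonal to the
   tangent cone of [Gamma], and [b k] vanishes with [r k] because the lower
   bound [gammaB] is uniform in [k]. *)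
pose r k := v_ k - adjoint_diff B (z k) v.
have r0 : r @ \oo --> (0 : 'rV[R]_n).
  rewrite -(subrr (adjoint_diff B (zhat o) v)); apply: cvgB => //.
  by apply: cvg_adjoint_diff => //; exact: cvg_cst.
have /choice[b Hb] k : exists b : 'rV[R]_m, gammaB * enorm b <= enorm (r (k + N)%N) /\
    forall w, lin_space G D (z (k + N)%N) w ->
      dot b (w *m 'J B (z (k + N)%N)) = dot (r (k + N)%N) w.
  have zGW : (Gamma `&` Wt) (z (k + N)%N).
    by split; [exact: Gzk | apply: hWWt; case: (WON k)].
  have lb w' : lin_space G D (z (k + N)%N) w' ->
      gammaB * enorm w' <= enorm (w' *m 'J B (z (k + N)%N)).
    by rewrite -diffE_jacobian; exact: hlb.
  exact: (riesz_lower_bound (lin_space G D (z (k + N)%N)) ('J B (z (k + N)%N))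
    gammaB (r (k + N)%N) (lin_space0 _ _ _)
    (fun a u u' => lin_space_lin _ _ _ a u u') hgamma lb).
have b0 : b @ \oo --> (0 : 'rV[R]_m).
  exact: (cvg0_enorm_le gammaB b (fun k => r (k + N)%N) hgamma
    (fun k => proj1 (Hb k)) (cvg_shift N r 0 r0)).
have [t0 _] := tz.
(* These directions place [o + t k *: h k] exactly at [B (z k)]; they tend to
   ['d B (zhat o) w = eta]. *)
pose h k := (t k)^-1 *: (B (z k) - B (zhat o)).
have oE k : o + t k *: h k = B (z k).
  by rewrite scalerA divff ?gt_eqF// scale1r Bz addrC subrK.
exists (fun k => t (k + N)%N), (fun k => h (k + N)%N), (fun k => v + b k).
split=> [|||k].
- exact: to_zero_pos_shift.
- by apply: cvg_shift; rewrite -Bw; exact: diff_quotient_cvg_lim.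
- by rewrite -[X in _ --> X]addr0; apply: cvgD => //; exact: cvg_cst.
have [WN ON] := WON k; have [_ bE] := Hb k.
rewrite oE; apply/regP; first by split=> //; exact: OmegaB.
rewrite zhatB//.
(* By definition of [r], the adjoint applied to [v + b k] is the given normal plus the difference
   between the adjoint of [b k] and [r (k + N)]. The choice of [b] makes that difference orthogonal
   to every tangent of [Gamma], hence itself a regular normal. *)
have -> : adjoint_diff B (z (k + N)%N) (v + b k) =
    v_ (k + N)%N + (adjoint_diff B (z (k + N)%N) (b k) - r (k + N)%N).
  have swap (a c d : 'rV[R]_n) : a + c = d + (c - (d - a)).
    by rewrite opprB addrCA [d + _]addrC subrK addrC.
  by rewrite {1}/adjoint_diff mulmxDl; exact: swap.
apply: regular_normal_coneD; first exact: Nv.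
apply: regular_normal_cone_polar => // u Tu.
by rewrite dotBl dot_adjoint_diff diffE_jacobian bE ?subrr//; exact: TL.
Unshelve. all: by end_near. Qed.
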